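(* There is a deterministic algorithm which, given $s,k\in\mathbb{N}$ and an $(s,k)$-puzzle $P$, determines whether $P$ is a simplifiable SUSP, and which runs in time polynomial in $s$ and $k$.
   Context: Puzzles. For $s,k\in\mathbb{N}$, an $(s,k)$-puzzle is a subset $P\subseteq\{1,2,3\}^k$ with $|P|=s$ (elements of $P$ are called rows). 3D graphs. A 3D graph $H$ with finite domain $U$ is given by an edge set $E(H)\subseteq U^3$ (a 3-uniform hypergraph on three disjoint copies of $U$). Its projections are the 2D graphs $R_0,R_1,R_2$ on $U$ with edge sets $E(R_0)=\{(v,w): \exists u,\ (u,v,w)\in E(H)\}$, $E(R_1)=\{(u,w):\exists v,\ (u,v,w)\in E(H)\}$, $E(R_2)=\{(u,v):\exists w,\ (u,v,w)\in E(H)\}$. The trivial matching on $U$ is $\{(u,u,u):u\in U\}$. Simplification. Let $S\subseteq U$ and $f\in\{0,1,2\}$. $S$ induces a simplification of $R_f$ if $E(R_f)\cap (S\times(U\setminus S))=\emptyset$ or $E(R_f)\cap((U\setminus S)\times S)=\emptyset$. In that case the simplification of $H$ induced by $S$ via $R_f$ is the 3D graph obtained from $H$ by deleting every edge whose projection to $R_f$ (i.e. the pair obtained by dropping the first, second, or third coordinate for $f=0,1,2$ respectively) lies in $(S\times(U\setminus S))\cup((U\setminus S)\times S)$. $H$ simplifies to $H'$ if there is a finite (possibly empty) sequence $H=H_0,H_1,\dots,H_\ell=H'$ and pairs $(S_j,f_j)$ such that $H_j$ is the simplification of $H_{j-1}$ induced by $S_j$ via the projection $R_{f_j}$ of $H_{j-1}$,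 for each $1\le j\le \ell$ (projections are recomputed at each step). The graph $H_P$. For a puzzle $P\subseteq\{1,2,3\}^k$, $H_P$ is the 3D graph with domain $P$ in which $(u,v,w)\in P^3$ is an edge if and only if there is no $i\in\{1,\dots,k\}$ such that exactly two of the conditions $u_i=1$, $v_i=2$, $w_i=3$ hold. Simplifiable SUSP. An $(s,k)$-puzzle $P$ is a simplifiable SUSP (strong uniquely solvable puzzle) if $H_P$ simplifies to the 3D graph whose edge set is the trivial matching $\{(u,u,u):u\in P\}$. *)

(* Defs.v *)
From mathcomp Require Import all_boot all_order all_algebra.
Set Implicit Arguments.
Unset Strict Implicit.
Unset Printing Implicit Defensive.

(** * 3D graphs and their simplifications *)

(* A 3D graph with domain [U] is identified with its edge set; the edge
   (u, v, w) is the left-nested pair ((u, v), w). *)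
Notation graph3 U := {set U * U * U}.

Section Simplification.
Variable U : finType.
Implicit Types (H : graph3 U) (S : {set U}) (f : 'I_3).

Definition drop_coord f (e : U * U * U) : U * U :=
  let: (u, v, w) := e in
  match nat_of_ord f with
  | 0 => (v, w)
  | 1 => (u, w)
  | _ => (u, v)
  end.

Definition projection f H : {set U * U} := [set drop_coord f e | e in H].

Definition trivial_matching : graph3 U := [set (u, u, u) | u : U].

Definition induces_simplification H S f : bool :=
  (projection f H :&: setX S (~: S) == set0)
  || (projection f H :&: setX (~: S) S == set0).

Definition simplification H S f : graph3 U :=
  [set e in H | drop_coord f e \notin setX S (~: S) :|: setX (~: S) S].

Definition simplification_step : rel (graph3 U) := fun H H' =>
  [exists S : {set U}, exists f : 'I_3,
     induces_simplification H S f && (H' == simplification H S f)].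

Definition simplifies_to H H' : bool := connect simplification_step H H'.

End Simplification.

(** * Puzzles *)

(* [a : 'I_3] stands for the symbol [a + 1] of the alphabet {1, 2, 3}. *)
Notation puzzle_row k := (k.-tuple 'I_3).

Definition symbol (a : 'I_3) : nat := a.+1.

Definition is_puzzle (s k : nat) (P : {set puzzle_row k}) : Prop := #|P| = s.

Definition puzzle_edge (k : nat) (u v w : puzzle_row k) : bool :=
  ~~ [exists i : 'I_k,
        (symbol (tnth u i) == 1) + (symbol (tnth v i) == 2)
        + (symbol (tnth w i) == 3) == 2].

(* The domain of H_P is the subtype of the rows belonging to [P]. *)
Definition puzzle_graph (k : nat) (P : {set puzzle_row k}) :
    graph3 {u : puzzle_row k | u \in P} :=
  [set e | puzzle_edge (val e.1.1) (val e.1.2) (val e.2)].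

Definition simplifiable_SUSP (k : nat) (P : {set puzzle_row k}) : bool :=
  simplifies_to (puzzle_graph P)
    (trivial_matching {u : puzzle_row k | u \in P}).

(** * Algorithms: random access machines *)

(* The machines of Cook and Reckhow (1973), with natural numbers in the
   registers, a sequential input tape and an explicit verdict.  Every
   instruction takes one unit of time.  As addition and (truncated)
   subtraction are the only arithmetic operations, registers hold numbers
   whose bit length is at most linear in the number of steps executed and in
   the bit lengths of the program constants and input entries, so that
   polynomial time on these machines and on Turing machines coincide. *)
Inductive instr : Type :=
| Const of nat & nat
| Add of nat & nat & nat
| Sub of nat & nat & nat
| LoadInd of nat & nat
| StoreInd of nat & nat
| Read of nat
| Jpos of nat & nat
| Halt of bool.

Definition program := seq instr.

Record config := Config {
  pc : nat;
  reg : nat -> nat;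
  input : seq nat
}.

Definition set_reg (X : nat -> nat) (i v : nat) : nat -> nat :=
  fun j => if j == i then v else X j.

(* Reading past the end of the input yields 0. *)
Definition exec (a : instr) (c : config) : config + bool :=
  let: Config q X inp := c in
  match a with
  | Const i n => inl (Config q.+1 (set_reg X i n) inp)
  | Add i j l => inl (Config q.+1 (set_reg X i (X j + X l)) inp)
  | Sub i j l => inl (Config q.+1 (set_reg X i (X j - X l)) inp)
  | LoadInd i j => inl (Config q.+1 (set_reg X i (X (X j))) inp)
  | StoreInd i j => inl (Config q.+1 (set_reg X (X i) (X j)) inp)
  | Read i    => inl (Config q.+1 (set_reg X i (head 0 inp)) (behead inp))
  | Jpos j m  => inl (Config (if 0 < X j then m else q.+1) X inp)
  | Halt b    => inr b
  end.

(* [run M t c] is [Some b] when [M], started in [c], executes [Halt b] within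
   [t] steps; a machine whose program counter leaves the program is stuck and
   never gives a verdict. *)
Fixpoint run (M : program) (t : nat) (c : config) : option bool :=
  if t is t'.+1 then
    if onth M (pc c) is Some a then
      match exec a c with
      | inl c' => run M t' c'
      | inr b => Some b
      end
    else None
  else None.

Definition initial_config (inp : seq nat) : config :=
  Config 0 (fun=> 0) inp.

(* A puzzle is presented to the machine by an arbitrary listing of its rows
   without repetition. *)
Definition is_listing (k : nat) (P : {set puzzle_row k})
    (l : seq (puzzle_row k)) : Prop :=
  uniq l /\ l =i P.

Definition encode_puzzle (s k : nat) (l : seq (puzzle_row k)) : seq nat :=
  s :: k :: flatten [seq map symbol (r : seq 'I_3) | r : puzzle_row k <- l].

(* The value at (s, k) of a polynomial in two variables with natural number
   coefficients. *)
Definition eval2 (p : {poly {poly nat}}) (s k : nat) : nat :=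
  (p.[s%:P].[k])%R.

(* Main.v *)
Require Import Defs.
From mathcomp Require Import all_boot all_order all_algebra zify.

(** Call a subgraph K of H stable if in every projection of K each projected
    edge lies on a directed cycle.  A simplification never deletes an edge of
    a stable subgraph, because a cycle crossing S crosses it in both
    directions.  Conversely, an edge (a, b) of R_f that lies on no cycle is
    deleted by S = {x : x reachable from b}.  Hence H simplifies to the trivial
    matching iff its largest stable subgraph is trivial, and that subgraph
    is reached by deleting, at most |U|^3 times in a row, all edges lying on
    no cycle of some R_f, with reachability computed by Warshall's method.

    Every loop of this procedure is bounded by s or by k, so its running time
    is a polynomial read off the syntax of the program. *)

Set Implicit Arguments.
Unset Strict Implicit.
Unset Printing Implicit Defensive.

(** * Bounds in two variables *)

(** A simplification may use any of exponentially many sets [S], and a bad choice might block a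
    later one. Stable subgraphs remove both worries, since no choice can damage them. Pruning itself
    is never decomposed into simplifications: the end of a run of simplifications that stops only at
    a stable graph is squeezed between the trivial matching and the pruned graph. The machine has
    absolute jumps and one flat memory, so correctness and time are proved once, for a compiler from
    a small loop language; the algorithm is then verified on the semantics of that language. No loop
    exits early: [s^3] rounds of pruning are always made, because [s^3] bounds the number of edges,
    and the time bound never depends on the data. *)

Lemma eval2D (p q : {poly {poly nat}}) s k :
  eval2 (p + q)%R s k = eval2 p s k + eval2 q s k.
Proof. by rewrite /eval2 !hornerD. Qed.

Lemma eval2M (p q : {poly {poly nat}}) s k :
  eval2 (p * q)%R s k = eval2 p s k * eval2 q s k.
Proof. by rewrite /eval2 !hornerM. Qed.

Lemma eval2_nat n s k : eval2 n%:R%R s k = n.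
Proof.
rewrite /eval2; elim: n => [|n IH]; first by rewrite !horner0.
by rewrite -GRing.natr1 !hornerD IH !hornerC; lia.
Qed.

Lemma eval2X s k : eval2 'X%R s k = s.
Proof. by rewrite /eval2 hornerX hornerC. Qed.

Lemma eval2XC s k : eval2 ('X%:P)%R s k = k.
Proof. by rewrite /eval2 hornerC hornerX. Qed.

Definition eval2E := (eval2D, eval2M, eval2_nat, eval2X, eval2XC).

(** * Execution of code segments *)

(** Quantifying over the remaining fuel [m] makes segments compose by associativity of addition,
    whatever happens later. *)
Definition reaches M n c c' := forall m, run M (n + m) c = run M m c'.

Lemma reaches_trans M n n' c c' c'' :
  reaches M n c c' -> reaches M n' c' c'' -> reaches M (n + n') c c''.
Proof. by move=> h h' m; rewrite -addnA h h'. Qed.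

(** Jump targets are absolute, so a segment only makes sense together with its address [q]. *)
Fixpoint code_at (M : program) q (code : program) : Prop :=
  if code is a :: code' then onth M q = Some a /\ code_at M q.+1 code'
  else True.

Lemma code_at_cat M q c1 c2 :
  code_at M q (c1 ++ c2) <-> code_at M q c1 /\ code_at M (q + size c1) c2.
Proof.
elim: c1 q => [|a c1 IH] q /=; first by rewrite addn0; tauto.
by rewrite IH addSnnS; tauto.
Qed.

Lemma code_at_self pre code post :
  code_at (pre ++ code ++ post) (size pre) code.
Proof.
elim: code pre => [//|a code IH] pre /=; split.
  by elim: pre.
by have := IH (rcons pre a); rewrite size_rcons cat_rcons.
Qed.

(** On [Halt] the value is a dummy: [effect] is meant for [straight] code. *)
Definition effect c a := if exec a c is inl c' then c' else c.

Definition straight a :=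
  match a with Jpos _ _ | Halt _ => false | _ => true end.

Lemma reaches_straight M code q X inp :
  code_at M q code -> all straight code ->
  reaches M (size code) (Config q X inp) (foldl effect (Config q X inp) code).
Proof.
elim: code q X inp => [//|a code IH] q X inp /= [ha hc] /andP[sa sc] m.
by case: a ha sa => //= >; move=> ha _; rewrite ha; apply: IH.
Qed.

Lemma reaches_exec M q X inp a c' :
  onth M q = Some a -> exec a (Config q X inp) = inl c' ->
  reaches M 1 (Config q X inp) c'.
Proof.
move=> h ha m; rewrite add1n.
by rewrite -[LHS]/(if onth M q is Some a then _ else _) h ha.
Qed.

Lemma reaches_jump M q X inp j q' :
  onth M q = Some (Jpos j q') ->
  reaches M 1 (Config q X inp) (Config (if 0 < X j then q' else q.+1) X inp).
Proof. by move=> h; apply: reaches_exec h _. Qed.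

(** * A loop language and its compilation *)

Inductive array := Puzzle | Edges | Reach.

(** These are also the only factors in [Times]: a product is compiled to a loop of additions, whose
    length must be polynomial. *)
Inductive bound := Rows | Cols.

(* [Var i] is a de Bruijn index: the counter of the [i]-th enclosing loop. *)
Inductive expr :=
| Var of nat
| Num of nat
| Plus of expr & expr
| Minus of expr & expr
| Times of expr & bound
| Get of array & expr.

Inductive cmd :=
| Put of array & expr & expr
| Input of array & expr
| When of expr & cmd
| For of bound & cmd
| Seq of cmd & cmd.

Record memory := Memory {
  puzzle : nat -> nat;
  edges : nat -> nat;
  reach : nat -> nat;
  tape : seq nat
}.

Definition get m a :=
  match a with Puzzle => puzzle m | Edges => edges m | Reach => reach m end.

Definition put m a x v :=
  match a with
  | Puzzle => Memory (set_reg (puzzle m) x v) (edges m) (reach m) (tape m)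
  | Edges => Memory (puzzle m) (set_reg (edges m) x v) (reach m) (tape m)
  | Reach => Memory (puzzle m) (edges m) (set_reg (reach m) x v) (tape m)
  end.

Definition untape m :=
  Memory (puzzle m) (edges m) (reach m) (behead (tape m)).

(* Loops count down: the loop counter of the machine is then its only loop
   register, and it ends at 0. *)
Fixpoint forloop n (f : nat -> memory -> memory) m :=
  if n is j.+1 then forloop j f (f j m) else m.

Lemma forloop_ind (I : nat -> memory -> Prop) n f m :
  I n m -> (forall j m', j < n -> I j.+1 m' -> I j (f j m')) ->
  I 0 (forloop n f m).
Proof.
elim: n m => [//|n IH] m /= h hf.
by apply: IH => [|j m' /ltnW hj]; apply: hf.
Qed.

Section Language.
Variables s k : nat.

Definition bound_value b := if b is Rows then s else k.

Fixpoint eval (env : seq nat) m e :=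
  match e with
  | Var i => nth 0 env i
  | Num n => n
  | Plus e1 e2 => eval env m e1 + eval env m e2
  | Minus e1 e2 => eval env m e1 - eval env m e2
  | Times e b => eval env m e * bound_value b
  | Get a e => get m a (eval env m e)
  end.

Fixpoint sem (env : seq nat) m c :=
  match c with
  | Put a e1 e2 => put m a (eval env m e1) (eval env m e2)
  | Input a e => put (untape m) a (eval env m e) (head 0 (tape m))
  | When e c => if 0 < eval env m e then sem env m c else m
  | For b c => forloop (bound_value b) (fun j m => sem (j :: env) m c) m
  | Seq c1 c2 => sem env (sem env m c1) c2
  end.

(* Registers divisible by 4 form a stack: [s], [k], the counters of the
   enclosing loops, then temporaries.  The residue classes 1, 2, 3 modulo 4
   hold the three arrays, so that no allocation is necessary. *)
Definition stack i := 4 * i.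

Definition residue a :=
  match a with Puzzle => 1 | Edges => 2 | Reach => 3 end.

Definition cell a x := 4 * x + residue a.

Definition bound_reg b := if b is Rows then stack 0 else stack 1.

Definition cell_code a t :=
  [:: Add (stack t) (stack t) (stack t); Add (stack t) (stack t) (stack t);
      Const (stack t.+1) (residue a);
      Add (stack t) (stack t) (stack t.+1)].

(* The test is the last instruction and is reached first, by jumping on a
   register holding 1, since [Jpos] is the only jump of the machine. *)
Definition loop_code q t b (body : program) : program :=
  [:: Const (stack t) 0; Add (stack t) (stack t) (bound_reg b);
      Const (stack t.+1) 1; Jpos (stack t.+1) (q + 6 + size body);
      Const (stack t.+1) 1; Defs.Sub (stack t) (stack t) (stack t.+1)]
  ++ body ++ [:: Jpos (stack t) (q + 4)].

(* [d] is the number of enclosing loops, [t] the first free stack cell. *)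
Fixpoint compile_expr d q t e : program :=
  match e with
  | Var i =>
      (* Counters occupy stack cells 2 to [d + 1], the innermost last; an index out of range yields
         the default 0 of [nth]. *)
      if i < d then
        [:: Const (stack t) 0; Add (stack t) (stack t) (stack (d.+1 - i))]
      else [:: Const (stack t) 0]
  | Num n => [:: Const (stack t) n]
  | Plus e1 e2 =>
      let c1 := compile_expr d q t e1 in
      c1 ++ compile_expr d (q + size c1) t.+1 e2
      ++ [:: Add (stack t) (stack t) (stack t.+1)]
  | Minus e1 e2 =>
      let c1 := compile_expr d q t e1 in
      c1 ++ compile_expr d (q + size c1) t.+1 e2
      ++ [:: Defs.Sub (stack t) (stack t) (stack t.+1)]
  | Times e b =>
      let c := compile_expr d q t e in
      c ++ [:: Const (stack t.+1) 0]
      ++ loop_code (q + size c + 1) t.+2 b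
           [:: Add (stack t.+1) (stack t.+1) (stack t)]
      ++ [:: Const (stack t) 0; Add (stack t) (stack t) (stack t.+1)]
  | Get a e =>
      compile_expr d q t e ++ cell_code a t
      ++ [:: LoadInd (stack t) (stack t)]
  end.

Fixpoint compile d q c : program :=
  let t := d.+2 in
  match c with
  | Put a e1 e2 =>
      let c2 := compile_expr d q t e2 in
      c2 ++ compile_expr d (q + size c2) t.+1 e1 ++ cell_code a t.+1
      ++ [:: StoreInd (stack t.+1) (stack t)]
  | Input a e =>
      compile_expr d q t e ++ cell_code a t
      ++ [:: Read (stack t.+1); StoreInd (stack t) (stack t.+1)]
  | When e c =>
      let c1 := compile_expr d q t e in
      let c2 := compile d (q + size c1 + 3) c in
      c1 ++ [:: Jpos (stack t) (q + size c1 + 3); Const (stack t) 1;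
                Jpos (stack t) (q + size c1 + 3 + size c2)] ++ c2
  | For b c => loop_code q t b (compile d.+1 (q + 6) c)
  | Seq c1 c2 =>
      let p1 := compile d q c1 in p1 ++ compile d (q + size p1) c2
  end.

Definition bound_poly b : {poly {poly nat}} :=
  if b is Rows then 'X%R else ('X%:P)%R.

Fixpoint expr_time e : {poly {poly nat}} :=
  (match e with
  | Var _ => 2%:R
  | Num _ => 1%:R
  | Plus e1 e2 | Minus e1 e2 => expr_time e1 + expr_time e2 + 1%:R
  (* Clearing the accumulator and copying the product take 1 + 2 steps, the loop
     [5 + b * (1 + 3)]. *)
  | Times e b => expr_time e + (8%:R + bound_poly b * 4%:R)
  | Get _ e => expr_time e + 5%:R
  end)%R.

Fixpoint cmd_time c : {poly {poly nat}} :=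
  (match c with
  | Put _ e1 e2 => expr_time e1 + expr_time e2 + 5%:R
  | Input _ e => expr_time e + 6%:R
  | When e c => expr_time e + 3%:R + cmd_time c
  (* Four instructions of entry and the last test make 5; each round adds a test and a decrement in
     two instructions. *)
  | For b c => 5%:R + bound_poly b * (cmd_time c + 3%:R)
  | Seq c1 c2 => cmd_time c1 + cmd_time c2
  end)%R.

(** * Correctness of the compiler *)

Lemma eval2_bound b : eval2 (bound_poly b) s k = bound_value b.
Proof. by case: b; rewrite eval2E. Qed.

(** Frame condition for expressions: the arrays and the stack below [t] survive. For commands, which
    write to the arrays, [represents] takes its place. *)
Definition agree t (X X' : nat -> nat) :=
  forall i, (forall j, t <= j -> i <> stack j) -> X' i = X i.

Definition represents (X : nat -> nat) env m :=
  [/\ X (stack 0) = s, X (stack 1) = k,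
      forall i, i < size env -> X (stack ((size env).+1 - i)) = nth 0 env i &
      forall a x, X (cell a x) = get m a x].

Lemma agree_trans t X Y Z : agree t X Y -> agree t Y Z -> agree t X Z.
Proof. by move=> h h' i hi; rewrite h' // h. Qed.

Lemma agree_weaken t u X X' : t <= u -> agree u X X' -> agree t X X'.
Proof. by move=> tu h i hi; apply: h => j /(leq_trans tu)/hi. Qed.

Lemma agree_set t X j v : t <= j -> agree t X (set_reg X (stack j) v).
Proof. by move=> tj i /(_ j tj) /eqP/negPf; rewrite /set_reg => ->. Qed.

Lemma agree_stack t X X' i :
  agree t X X' -> i < t -> X' (stack i) = X (stack i).
Proof. by move=> h it; apply: h => j tj; rewrite /stack; lia. Qed.

Lemma agree_cell t X X' a x : agree t X X' -> X' (cell a x) = X (cell a x).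
Proof. by apply=> j _; rewrite /stack /cell; case: a => /=; lia. Qed.

Lemma represents_agree t X X' env m :
  size env + 2 <= t -> agree t X X' -> represents X env m ->
  represents X' env m.
Proof.
move=> ht hX [h0 h1 hv hc]; split.
- by rewrite (agree_stack hX) //; lia.
- by rewrite (agree_stack hX) //; lia.
- by move=> i hi; rewrite (agree_stack hX) ?hv //; lia.
- by move=> a x; rewrite (agree_cell _ _ hX).
Qed.

Lemma represents_bound X env m b :
  represents X env m -> X (bound_reg b) = bound_value b.
Proof. by case=> h0 h1 _ _; case: b. Qed.

Lemma stack_inj : injective stack.
Proof. by rewrite /stack => i j; lia. Qed.

Lemma stack_eq i j : (stack i == stack j) = (i == j).
Proof. exact: inj_eq stack_inj _ _. Qed.

Lemma get_put m a x v b y :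
  get (put m a x v) b y
    = if cell b y == cell a x then v else get m b y.
Proof.
case: a; case: b; rewrite /= /set_reg; case: (y =P x) => h;
  case: eqP => //; rewrite /cell /=; lia.
Qed.

Lemma set_reg_eq X i v : set_reg X i v i = v.
Proof. by rewrite /set_reg eqxx. Qed.

Lemma set_reg_stack X i v j : set_reg X (stack i) v (stack j) =
  if j == i then v else X (stack j).
Proof. by rewrite /set_reg stack_eq. Qed.

(** Serves both [For] and the multiplication inside [Times]. Loop control writes cells [t] and
    [t.+1], hence the demand that [I] survive changes from [t] on; the body must give the counter
    back intact. *)
Lemma loop_correct M q t b body T (I : nat -> (nat -> nat) -> seq nat -> Prop)
    X inp :
  code_at M q (loop_code q t b body) -> 1 < t ->
  X (bound_reg b) = bound_value b ->
  (forall j X X' inp, agree t X X' -> I j X inp -> I j X' inp) ->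
  (forall j X inp, j < bound_value b -> X (stack t) = j -> I j.+1 X inp ->
     exists n X' inp', [/\ n <= T,
       reaches M n (Config (q + 6) X inp)
         (Config (q + 6 + size body) X' inp'),
       X' (stack t) = j & I j X' inp']) ->
  I (bound_value b) X inp ->
  exists n X' inp', [/\ n <= 5 + bound_value b * (T + 3),
    reaches M n (Config q X inp)
      (Config (q + size (loop_code q t b body)) X' inp') & I 0 X' inp'].
Proof.
move=> /code_at_cat[] hpre /code_at_cat[] _ /= [htest _] t1 hb hI hbody hinit.
(* The induction starts at the test, where the entry jump and the end of every round meet. *)
have iter j Y inp0 : j <= bound_value b -> Y (stack t) = j -> I j Y inp0 ->
    exists n X' inp', [/\ n <= 1 + j * (T + 3),
      reaches M n (Config (q + 6 + size body) Y inp0)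
        (Config (q + 6 + size body).+1 X' inp') & I 0 X' inp'].
  elim: j Y inp0 => [|j IH] Y inp0 hj hY hIY.
    exists 1, Y, inp0; split=> //.
    by have := @reaches_jump _ _ Y inp0 _ _ htest; rewrite hY.
  pose Y' := set_reg (set_reg Y (stack t.+1) 1) (stack t) j.
  have hY' : agree t Y Y'.
    by apply: agree_trans (agree_set _ _ _) (agree_set _ _ _); lia.
  have [||n [Z [inp1 [hn hr hZ hIZ]]]] := hbody j Y' inp0 hj.
  - by rewrite /Y' set_reg_eq.
  - exact: hI hIY.
  have [|n' [Z' [inp2 [hn' hr' hIZ']]]] := IH Z inp1 _ hZ hIZ; first by lia.
  exists (1 + 2 + n + n'), Z', inp2; split=> //; first by lia.
  apply: reaches_trans hr'; apply: reaches_trans hr.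
  apply: reaches_trans (@reaches_jump _ _ Y inp0 _ _ htest) _.
  rewrite hY /=; case: hpre => [_ [_ [_ [_ [h4 [h5 _]]]]]].
  have := @reaches_straight M [:: Const (stack t.+1) 1;
    Defs.Sub (stack t) (stack t) (stack t.+1)] q.+4 Y inp0.
  rewrite /= /effect /= !set_reg_stack !eqxx ltn_eqF // hY subn1 /=.
  by rewrite -/Y' addn4 -[q.+4.+2]/(6 + q) (addnC 6); apply.
pose Y := set_reg (set_reg (set_reg X (stack t) 0)
            (stack t) (bound_value b)) (stack t.+1) 1.
have hY : agree t X Y.
  apply: agree_trans (agree_set _ _ _) => //.
  by apply: agree_trans (agree_set _ _ _) (agree_set _ _ _).
have [|n [Z [inp1 [hn hr hIZ]]]] :=
  iter _ Y inp (leqnn _) _ (hI _ _ _ _ hY hinit).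
  by rewrite /Y !set_reg_stack eqxx ltn_eqF.
exists (3 + 1 + n), Z, inp1; split=> //.
have -> : q + size (loop_code q t b body) = (q + 6 + size body).+1.
  by rewrite size_cat size_cat /=; lia.
apply: reaches_trans hr; move: hpre => -[h0 [h1 [h2 [h3 _]]]].
apply: reaches_trans.
  by apply: (@reaches_straight M [:: Const (stack t) 0;
   Add (stack t) (stack t) (bound_reg b); Const (stack t.+1) 1]).
rewrite /= /effect /= set_reg_eq add0n.
(* As [1 < t], clearing cell [t] has not destroyed the bound. *)
have -> : set_reg X (stack t) 0 (bound_reg b) = bound_value b.
  by rewrite -hb /set_reg; case: eqP => // hbt; case: (b) hbt => /=;
    rewrite /stack; lia.
by have := @reaches_jump _ _ Y inp _ _ h3; rewrite /Y set_reg_eq.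
Qed.

Lemma cell_code_correct M q a t X inp :
  code_at M q (cell_code a t) ->
  exists X', [/\ reaches M 4 (Config q X inp) (Config (q + 4) X' inp),
    X' (stack t) = cell a (X (stack t)) & agree t X X'].
Proof.
move=> h; eexists; split.
- have := @reaches_straight M _ q X inp h isT.
  by rewrite /effect /= -(addn4 q); apply.
- rewrite /= !set_reg_stack !eqxx.
  by do !(case: eqP => [|_]; first by lia); rewrite /cell; lia.
- by do !apply: agree_trans (agree_set _ _ _).
Qed.

Lemma compile_expr_correct M env m inp e q t X :
  code_at M q (compile_expr (size env) q t e) ->
  represents X env m -> size env + 2 <= t ->
  exists n X', [/\ n <= eval2 (expr_time e) s k,
    reaches M n (Config q X inp)
      (Config (q + size (compile_expr (size env) q t e)) X' inp),
    X' (stack t) = eval env m e & agree t X X'].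
Proof.
(* [Plus] and [Minus] differ only in their last instruction. *)
have binary f (op : nat -> nat -> nat -> instr) e1 e2 q0 t0 X0 :
    (forall c i j l, exec (op i j l) c =
       inl (Config (pc c).+1 (set_reg (reg c) i (f (reg c j) (reg c l)))
              (input c))) ->
    (forall q t X, code_at M q (compile_expr (size env) q t e1) ->
      represents X env m -> size env + 2 <= t ->
      exists n X', [/\ n <= eval2 (expr_time e1) s k,
        reaches M n (Config q X inp)
          (Config (q + size (compile_expr (size env) q t e1)) X' inp),
        X' (stack t) = eval env m e1 & agree t X X']) ->
    (forall q t X, code_at M q (compile_expr (size env) q t e2) ->
      represents X env m -> size env + 2 <= t ->
      exists n X', [/\ n <= eval2 (expr_time e2) s k,
        reaches M n (Config q X inp)
          (Config (q + size (compile_expr (size env) q t e2)) X' inp),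
        X' (stack t) = eval env m e2 & agree t X X']) ->
    let c1 := compile_expr (size env) q0 t0 e1 in
    let c2 := compile_expr (size env) (q0 + size c1) t0.+1 e2 in
    let code := c1 ++ c2 ++ [:: op (stack t0) (stack t0) (stack t0.+1)] in
    code_at M q0 code -> represents X0 env m -> size env + 2 <= t0 ->
    exists n X', [/\
      n <= eval2 (expr_time e1) s k + eval2 (expr_time e2) s k + 1,
      reaches M n (Config q0 X0 inp) (Config (q0 + size code) X' inp),
      X' (stack t0) = f (eval env m e1) (eval env m e2) & agree t0 X0 X'].
  move=> hop IH1 IH2 c1 c2 code /code_at_cat[] h1 /code_at_cat[] h2 [h3 _].
  move=> hX ht.
  have [n1 [X1 [hn1 r1 v1 a1]]] := IH1 _ _ _ h1 hX ht.
  have [n2 [X2 [hn2 r2 v2 a2]]] :=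
    IH2 _ _ _ h2 (represents_agree ht a1 hX) (leqW ht).
  exists (n1 + n2 + 1),
    (set_reg X2 (stack t0) (f (X2 (stack t0)) (X2 (stack t0.+1)))).
  split; first by lia.
  - apply: reaches_trans (reaches_trans r1 r2) _; apply: reaches_exec h3 _.
    rewrite hop !size_cat /=; congr (inl (Config _ _ _)); lia.
  - by rewrite set_reg_eq (agree_stack a2) // v1 v2.
  - apply: agree_trans a1 (agree_trans (agree_weaken _ a2) _) => //.
    exact: agree_set.
elim: e q t X => [i|n|e1 IH1 e2 IH2|e1 IH1 e2 IH2|e IH b|a e IH] q t X;
  rewrite [expr_time _]/= ?eval2E.
- rewrite /=; case: ifP => hi h hX ht.
  + exists 2, (set_reg (set_reg X (stack t) 0) (stack t) (nth 0 env i)).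
    split=> //.
    * have := @reaches_straight M _ q X inp h isT.
      rewrite /effect /= set_reg_eq set_reg_stack ltn_eqF; last by lia.
      by case: hX => _ _ -> // _; rewrite addn2.
    * by rewrite set_reg_eq.
    * by apply: agree_trans (agree_set _ _ _) (agree_set _ _ _).
  + exists 1, (set_reg X (stack t) 0); split=> //.
    * by have := @reaches_straight M _ q X inp h isT; rewrite addn1.
    * by rewrite set_reg_eq nth_default // leqNgt hi.
    * exact: agree_set.
- move=> h hX ht; exists 1, (set_reg X (stack t) n); split=> //.
  + by have := @reaches_straight M _ q X inp h isT; rewrite addn1.
  + by rewrite set_reg_eq.
  + exact: agree_set.
- by move=> h; apply: (binary addn Add _ _ _ _ _ _ IH1 IH2 h) => -[].
- by move=> h; apply: (binary subn Defs.Sub _ _ _ _ _ _ IH1 IH2 h) => -[].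
- rewrite eval2_bound; pose c := compile_expr (size env) q t e.
  pose L := loop_code (q + size c + 1) t.+2 b
              [:: Add (stack t.+1) (stack t.+1) (stack t)].
  rewrite -[compile_expr _ _ _ _]/(c ++ [:: Const (stack t.+1) 0] ++ L
    ++ [:: Const (stack t) 0; Add (stack t) (stack t) (stack t.+1)]).
  move=> /code_at_cat[] h1 /code_at_cat[] [h2 _] /code_at_cat[] h3 h4 hX ht.
  have [n1 [X1 [hn1 r1 v1 a1]]] := IH _ _ _ h1 hX ht.
  pose X2 := set_reg X1 (stack t.+1) 0.
  have a2 : agree t.+1 X1 X2 by exact: agree_set.
  pose x := eval env m e.
  (* The accumulator and the [j] additions still due give the full product. *)
  pose I j (Y : nat -> nat) inp' := [/\ inp' = inp,
    Y (stack t.+1) + j * x = bound_value b * x & agree t.+1 X2 Y].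
  have hX2 := represents_agree ht (agree_weaken (leqnSn _) a2)
                (represents_agree ht a1 hX).
  have [n3 [X3 [inp3 [hn3 r3 [einp hv a3]]]]] : exists n Y inp', [/\
      n <= 5 + bound_value b * (1 + 3),
      reaches M n (Config (q + size c + 1) X2 inp)
        (Config (q + size c + 1 + size L) Y inp') & I 0 Y inp'].
    apply: (loop_correct h3 _ (represents_bound b hX2)) => //.
    + move=> j Y Y' inp' hY [-> hj ha]; split=> //.
        by rewrite (agree_stack hY).
      by apply: agree_trans ha (agree_weaken _ hY).
    + move=> j Y inp' hj hYj [-> hjx ha].
      have hYt : Y (stack t) = x.
        by rewrite (agree_stack ha) // (agree_stack a2).
      exists 1, (set_reg Y (stack t.+1) (Y (stack t.+1) + Y (stack t))), inp.
      split=> //.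
      * case/code_at_cat: h3 => _ /code_at_cat[] h3 _.
        have := @reaches_straight M _ _ Y inp h3 isT.
        by rewrite /effect /= -[(_ + 6).+1]addn1.
      * by rewrite set_reg_stack gtn_eqF.
      * split=> //; last by apply: agree_trans ha (agree_set _ _ _).
        by rewrite set_reg_eq hYt -hjx mulSn; lia.
    + split=> //; by rewrite /X2 set_reg_eq.
  rewrite {}einp in r3.
  exists (n1 + 1 + n3 + 2),
    (set_reg (set_reg X3 (stack t) 0) (stack t) (x * bound_value b)); split.
  + by move: hn3; rewrite mulnDr; lia.
  + apply: (reaches_trans (c' := Config (q + size c + 1 + size L) X3 inp)).
      apply: reaches_trans r3; apply: reaches_trans r1 _.
      by apply: reaches_exec h2 _; rewrite addn1.
    have := @reaches_straight M _ _ X3 inp h4 isT.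
    rewrite /effect [foldl _ _ _]/= set_reg_eq set_reg_stack gtn_eqF //.
    rewrite add0n; move: hv; rewrite mul0n addn0 => ->; rewrite mulnC.
    rewrite !size_cat [size [:: _]]/= [size [:: _; _]]/= -/c -/L.
    have -> : (q + size c + 1 + size L).+2
            = q + (size c + (1 + (size L + 2))) by lia.
    by [].
  + by rewrite set_reg_eq.
  + apply: agree_trans (agree_trans (agree_set _ _ _) (agree_set _ _ _)) => //.
    apply: agree_trans a1 (agree_weaken (leqnSn _) (agree_trans a2 a3)).
- pose c := compile_expr (size env) q t e.
  rewrite -[compile_expr _ _ _ _]/(c ++ cell_code a t
    ++ [:: LoadInd (stack t) (stack t)]).
  move=> /code_at_cat[] h1 /code_at_cat[] h2 [h3 _] hX ht.
  have [n1 [X1 [hn1 r1 v1 a1]]] := IH _ _ _ h1 hX ht.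
  have [X2 [r2 v2 a2]] := cell_code_correct X1 inp h2.
  exists (n1 + 4 + 1), (set_reg X2 (stack t) (X2 (X2 (stack t)))); split.
  + by lia.
  + apply: reaches_trans (reaches_trans r1 r2) _; apply: reaches_exec h3 _.
    by rewrite !size_cat /=; congr (inl (Config _ _ _)); lia.
  + rewrite set_reg_eq v2 v1 (agree_cell _ _ a2) (agree_cell _ _ a1).
    by case: hX => _ _ _ ->.
  + by apply: agree_trans a1 (agree_trans a2 (agree_set _ _ _)).
Qed.

Lemma cell_stack a x i : (cell a x == stack i) = false.
Proof. by rewrite /cell /stack; case: a => /=; lia. Qed.

Lemma represents_put X env m a x v :
  represents X env m -> represents (set_reg X (cell a x) v) env (put m a x v).
Proof.
case=> h0 h1 hv hc; split.
- by rewrite /set_reg eq_sym cell_stack.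
- by rewrite /set_reg eq_sym cell_stack.
- by move=> i hi; rewrite /set_reg eq_sym cell_stack hv.
- by move=> b y; rewrite get_put -hc.
Qed.

Lemma represents_untape X env m :
  represents X env m -> represents X env (untape m).
Proof. by case=> h0 h1 hv hc; split=> // -[] x; rewrite hc. Qed.

(** Entering a loop makes the first free cell the newest counter and moves no older one. *)
Lemma represents_cons X env m j :
  represents X (j :: env) m
    <-> X (stack (size env).+2) = j /\ represents X env m.
Proof.
split=> [[h0 h1 hv hc]|[hj [h0 h1 hv hc]]].
  split; first exact: (hv 0).
  by split=> // i hi; have := hv i.+1 hi; rewrite subSS.
by split=> // -[|i] hi; rewrite ?subSS ?subn0 // hv.
Qed.

Lemma tape_put m a x v : tape (put m a x v) = tape m.
Proof. by case: a. Qed.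

Lemma compile_correct M c env m q X :
  code_at M q (compile (size env) q c) -> represents X env m ->
  exists n X', [/\ n <= eval2 (cmd_time c) s k,
    reaches M n (Config q X (tape m))
      (Config (q + size (compile (size env) q c)) X' (tape (sem env m c))) &
    represents X' env (sem env m c)].
Proof.
elim: c env m q X => [a e1 e2|a e|e c IH|b c IH|c1 IH1 c2 IH2] env m q X;
  rewrite [cmd_time _]/= ?eval2E.
- pose p2 := compile_expr (size env) q (size env).+2 e2.
  pose p1 := compile_expr (size env) (q + size p2) (size env).+3 e1.
  rewrite -[compile _ _ _]/(p2 ++ p1 ++ cell_code a (size env).+3
    ++ [:: StoreInd (stack (size env).+3) (stack (size env).+2)]).
  move=> /code_at_cat[] h2 /code_at_cat[] h1 /code_at_cat[] h3 [h4 _] hX.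
  have ht : size env + 2 <= (size env).+2 by rewrite addn2.
  have [n2 [X2 [hn2 r2 v2 a2]]] :=
    compile_expr_correct (tape m) h2 hX ht.
  have hX2 := represents_agree ht a2 hX.
  have [n1 [X1 [hn1 r1 v1 a1]]] :=
    compile_expr_correct (tape m) h1 hX2 (leqW ht).
  have hX1 := represents_agree (leqW ht) a1 hX2.
  have [X3 [r3 v3 a3]] := cell_code_correct X1 (tape m) h3.
  have hX3 := represents_agree (leqW ht) a3 hX1.
  exists (n2 + n1 + 4 + 1),
    (set_reg X3 (cell a (eval env m e1)) (eval env m e2)).
  split; first by lia.
  + apply: reaches_trans (reaches_trans (reaches_trans r2 r1) r3) _.
    apply: reaches_exec h4 _; rewrite /= v3 v1.
    rewrite (agree_stack a3) // (agree_stack a1) // v2 !size_cat tape_put.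
    by congr (inl (Config _ _ _)); rewrite /=; lia.
  + exact: represents_put.
- pose p := compile_expr (size env) q (size env).+2 e.
  rewrite -[compile _ _ _]/(p ++ cell_code a (size env).+2
    ++ [:: Read (stack (size env).+3);
           StoreInd (stack (size env).+2) (stack (size env).+3)]).
  move=> /code_at_cat[] h1 /code_at_cat[] h2 h3 hX.
  have ht : size env + 2 <= (size env).+2 by rewrite addn2.
  have [n1 [X1 [hn1 r1 v1 a1]]] := compile_expr_correct (tape m) h1 hX ht.
  have hX1 := represents_agree ht a1 hX.
  have [X2 [r2 v2 a2]] := cell_code_correct X1 (tape m) h2.
  have hX2 := represents_agree ht a2 hX1.
  have a3 : agree (size env).+2 X2
      (set_reg X2 (stack (size env).+3) (head 0 (tape m))) by exact: agree_set.
  exists (n1 + 4 + 2),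
    (set_reg (set_reg X2 (stack (size env).+3) (head 0 (tape m)))
      (cell a (eval env m e)) (head 0 (tape m))); split; first by lia.
  + apply: reaches_trans (reaches_trans r1 r2) _.
    have := @reaches_straight M _ _ X2 (tape m) h3 isT.
    rewrite /effect [foldl _ _ _]/= set_reg_eq set_reg_stack ltn_eqF //.
    rewrite v2 v1 tape_put !size_cat [size (cell_code _ _)]/=.
    rewrite [size [:: _; _]]/= -/p.
    by have -> : (q + size p + 4).+2 = q + (size p + (4 + 2)) by lia.
  + exact/represents_put/represents_untape/(represents_agree ht a3).
- pose p := compile_expr (size env) q (size env).+2 e.
  pose p' := compile (size env) (q + size p + 3) c.
  rewrite -[compile _ _ _]/(p ++ [::
    Jpos (stack (size env).+2) (q + size p + 3); Const (stack (size env).+2) 1;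
    Jpos (stack (size env).+2) (q + size p + 3 + size p')] ++ p').
  move=> /code_at_cat[] h1 /code_at_cat[] [h2 [h3 [h4 _]]] h5 hX.
  have ht : size env + 2 <= (size env).+2 by rewrite addn2.
  have [n1 [X1 [hn1 r1 v1 a1]]] := compile_expr_correct (tape m) h1 hX ht.
  have hX1 := represents_agree ht a1 hX.
  have := reaches_jump X1 (tape m) h2.
  have -> : q + size (p ++ [:: Jpos (stack (size env).+2) (q + size p + 3);
      Const (stack (size env).+2) 1; Jpos (stack (size env).+2)
      (q + size p + 3 + size p')] ++ p') = q + size p + 3 + size p'.
    by rewrite !size_cat /=; lia.
  rewrite v1 /=; case: ifP => _ r2.
  + have [n3 [X3 [hn3 r3 hX3]]] := IH _ _ _ _ h5 hX1.
    exists (n1 + 1 + n3), X3; split=> //; first by lia.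
    exact: reaches_trans (reaches_trans r1 r2) r3.
  + exists (n1 + 1 + 1 + 1), (set_reg X1 (stack (size env).+2) 1).
    split; first by lia.
      apply: reaches_trans
        (reaches_trans (reaches_trans r1 r2) (reaches_exec h3 (erefl _))) _.
      have := reaches_jump (set_reg X1 (stack (size env).+2) 1) (tape m) h4.
      by rewrite set_reg_eq.
    exact: represents_agree ht (agree_set _ _ _) hX1.
- rewrite eval2_bound.
  pose p := compile (size env).+1 (q + 6) c.
  pose f j m := sem (j :: env) m c.
  rewrite -[compile _ _ _]/(loop_code q (size env).+2 b p).
  move=> h hX.
  (* The rounds still to come lead from the represented memory to the final one. *)
  pose I j Y inp := exists m', [/\ represents Y env m', inp = tape m' &
    forloop j f m' = sem env m (For b c)].
  have [n [X' [inp' [hn r [m' [hX' einp hm']]]]]] : exists n X' inp', [/\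
      n <= 5 + bound_value b * (eval2 (cmd_time c) s k + 3),
      reaches M n (Config q X (tape m))
        (Config (q + size (loop_code q (size env).+2 b p)) X' inp') &
      I 0 X' inp'].
    apply: (loop_correct h _ (represents_bound b hX)) => //.
    + move=> j Y Y' inp hY [m' [hm' -> e]]; exists m'; split=> //.
      by apply: represents_agree hY hm'; rewrite addn2.
    + move=> j Y inp hj hYj [m' [hm' -> e]].
      have hp : code_at M (q + 6) (compile (size (j :: env)) (q + 6) c).
        by case/code_at_cat: h => _ /code_at_cat[].
      have [n [Y' [hn r]]] := IH _ _ _ _ hp
        (proj2 (represents_cons Y env m' j) (conj hYj hm')).
      case/represents_cons=> hj' hY'.
      by exists n, Y', (tape (f j m')); split=> //; exists (f j m').
    + by exists m.
  by exists n, X'; rewrite -hm' -einp.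
- pose p1 := compile (size env) q c1.
  pose p2 := compile (size env) (q + size p1) c2.
  rewrite -[compile _ _ _]/(p1 ++ p2) => /code_at_cat[] h1 h2 hX.
  have [n1 [X1 [hn1 r1 hX1]]] := IH1 _ _ _ _ h1 hX.
  have [n2 [X2 [hn2 r2 hX2]]] := IH2 _ _ _ _ h2 hX1.
  exists (n1 + n2), X2; split=> //; first by lia.
  by rewrite size_cat addnA; apply: reaches_trans r1 r2.
Qed.

(** * The complete machine *)

Definition decider c e : program :=
  let p := compile 0 2 c in
  let p' := compile_expr 0 (2 + size p) 2 e in
  [:: Read (stack 0); Read (stack 1)] ++ p ++ p'
  ++ [:: Jpos (stack 2) (2 + size p + size p' + 2); Halt false; Halt true].

(** The 4 extra steps are two [Read]s, the jump and one [Halt]. *)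
Definition decider_time c e : {poly {poly nat}} :=
  (cmd_time c + expr_time e + 4%:R)%R.

Lemma decider_correct c e inp :
  let blank := Memory (fun=> 0) (fun=> 0) (fun=> 0) inp in
  run (decider c e) (eval2 (decider_time c e) s k)
    (initial_config [:: s, k & inp])
    = Some (0 < eval [::] (sem [::] blank c) e).
Proof.
move=> m; set M := decider c e; rewrite /decider_time !eval2E.
have hM : code_at M 0 M by have := code_at_self [::] M [::]; rewrite cats0.
pose p := compile 0 2 c; pose p' := compile_expr 0 (2 + size p) 2 e.
have {hM} : code_at M 0 ([:: Read (stack 0); Read (stack 1)] ++ p ++ p'
  ++ [:: Jpos (stack 2) (2 + size p + size p' + 2); Halt false; Halt true]).
  exact: hM.
case/code_at_cat=> h0 /code_at_cat[] h1 /code_at_cat[] h2.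
rewrite add0n => -[h3 [h4 [h5 _]]].
pose X := set_reg (set_reg (fun=> 0) (stack 0) s) (stack 1) k.
have hX : represents X (@nil nat) m.
  by split=> // a x; rewrite /X /set_reg !cell_stack; case: a.
have [n1 [X1 [hn1 r1 hX1]]] := @compile_correct M c [::] m 2 X h1 hX.
have [n2 [X2 [hn2 r2 v2 a2]]] :=
  @compile_expr_correct M [::] _ (tape (sem [::] m c)) e _ 2 X1 h2 hX1 isT.
have r0 : reaches M 2 (initial_config [:: s, k & inp]) (Config 2 X (tape m)).
  exact: (@reaches_straight M _ 0 (fun=> 0) _ h0 isT).
have r3 := reaches_trans (reaches_trans (reaches_trans r0 r1) r2)
             (reaches_jump _ _ h3).
pose n := 2 + n1 + n2 + 1.
pose N := eval2 (cmd_time c) s k + eval2 (expr_time e) s k + 4.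
(* The time is only an upper bound; after the jump at least one unit of fuel remains, for [Halt]. *)
have -> : eval2 (cmd_time c) s k + eval2 (expr_time e) s k + 4
       = 2 + n1 + n2 + 1 + (N - n.+1).+1 by rewrite /N /n; lia.
rewrite r3 v2 /=; case: ifP => _.
  by rewrite addn2 h5.
by rewrite h4.
Qed.

End Language.

(** * Stable subgraphs *)

Lemma connect_closed (T : finType) (r : rel T) (P : T -> Prop) x y :
  (forall x y, r x y -> P x -> P y) -> connect r x y -> P x -> P y.
Proof.
move=> hP /connectP[p hp ->]; elim: p x hp => [//|z p IH] x /= /andP[xz hp].
by move=> /(hP _ _ xz); apply: IH.
Qed.

Section Stability.
Variable U : finType.
Implicit Types (H K : graph3 U) (f : 'I_3).

Definition pair_rel (r : {set U * U}) : rel U := fun x y => (x, y) \in r.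

(** A path from head back to tail closes the projected edge to a cycle; [connect] is reflexive, so
    loops always stay. *)
Definition prune f H : graph3 U :=
  [set e in H | connect (pair_rel (projection f H))
                  (drop_coord f e).2 (drop_coord f e).1].

Definition stable H := forall f, prune f H = H.

Definition coord i (hi : i < 3) : 'I_3 := Ordinal hi.

Definition prune_all H :=
  prune (coord (isT : 2 < 3)) (prune (coord (isT : 1 < 3))
    (prune (coord (isT : 0 < 3)) H)).

Lemma prune_sub f H : prune f H \subset H.
Proof. by apply/subsetP => e; rewrite inE => /andP[]. Qed.

Lemma connect_projection_sub f H K x y :
  K \subset H -> connect (pair_rel (projection f K)) x y ->
  connect (pair_rel (projection f H)) x y.
Proof.
move=> /subsetP KH; apply: connect_sub => {}x {}y /imsetP[e /KH eH he].
by apply: connect1; apply/imsetP; exists e.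
Qed.

Lemma stable_sub_prune f H K : stable K -> K \subset H -> K \subset prune f H.
Proof.
move=> hK KH; apply/subsetP => e eK; rewrite inE (subsetP KH) //=.
move: eK; rewrite -{1}(hK f) inE => /andP[_].
exact: connect_projection_sub.
Qed.

Lemma stable_sub_step H H' K :
  stable K -> K \subset H -> simplification_step H H' -> K \subset H'.
Proof.
move=> hK KH /existsP[S /existsP[f /andP[hS /eqP->]]].
apply/subsetP => e eK; rewrite inE (subsetP KH) //=.
have heH : drop_coord f e \in projection f H.
  by apply: imset_f; apply: (subsetP KH).
have : e \in prune f H by rewrite (subsetP (stable_sub_prune f hK KH)).
rewrite inE => /andP[_]; case: (drop_coord f e) heH => a b /= hab hba.
apply/negP; rewrite in_setU !in_setX !in_setC.
case/orP: hS => /eqP/setP hS.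
(* No edge of the projection leaves [S], so the path from [b] back to [a] cannot leave it either,
   which excludes an edge entering [S]. In the other case the complement of [S] plays this role. *)
- have cl x y : pair_rel (projection f H) x y -> x \in S -> y \in S.
    rewrite /pair_rel => hxy xS; apply/negPn/negP => yS.
    by have := hS (x, y); rewrite !inE /= hxy xS yS.
  case/orP=> /andP[h1 h2]; first by rewrite (cl _ _ hab h1) in h2.
  by rewrite (connect_closed (P := fun x => x \in S) cl hba h2) in h1.
- have cl x y : pair_rel (projection f H) x y -> x \notin S -> y \notin S.
    rewrite /pair_rel => hxy xS; apply/negP => yS.
    by have := hS (x, y); rewrite !inE /= hxy xS yS.
  case/orP=> /andP[h1 h2].
    by have := connect_closed (P := fun x => x \notin S) cl hba h2; rewrite h1.
  by have := cl _ _ hab h1; rewrite h2.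
Qed.

Lemma stable_sub_simplifies H H' K :
  stable K -> K \subset H -> simplifies_to H H' -> K \subset H'.
Proof.
move=> hK KH hH.
refine (connect_closed (P := fun X : graph3 U => K \subset X) _ hH KH).
move=> {KH hH}H {}H' hs KH'; exact: stable_sub_step hK KH' hs.
Qed.

Lemma trivial_matching_stable : stable (trivial_matching U).
Proof.
move=> f; apply/setP => e; rewrite inE andb_idr // => /imsetP[u _ ->].
by case: f => -[|[|[|]]].
Qed.

Lemma prune_step f H : prune f H != H ->
  exists2 H', simplification_step H H' & H' \proper H.
Proof.
rewrite eqEsubset prune_sub /= => /subsetPn[e eH].
rewrite inE eH /= => hba; pose a := (drop_coord f e).1.
pose b := (drop_coord f e).2; pose r := pair_rel (projection f H).
(* No edge leaves [S], which contains [b] but not [a], so [e] itself is deleted. *)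
pose S := [set x | connect r b x].
exists (simplification H S f).
  apply/existsP; exists S; apply/existsP; exists f; rewrite eqxx andbT.
  apply/orP; left; apply/eqP/setP => -[x y]; rewrite !inE /=; apply/negbTE.
  apply/negP => /and3P[hxy hbx /negP]; apply; apply: connect_trans hbx _.
  exact: connect1.
apply/properP; split; first by apply/subsetP => x; rewrite inE => /andP[].
exists e => //; rewrite inE eH [drop_coord f e]surjective_pairing -/a -/b.
by rewrite negbK in_setU !in_setX !inE connect0 andbT orbC hba.
Qed.

(** While the graph is not stable, some simplification loses an edge; the edge count bounds the
    run. *)
Lemma simplifies_to_stable H : exists2 H', simplifies_to H H' & stable H'.
Proof.
elim/(@ltn_ind): #|H| {-2}H (erefl #|H|) => n IH {}H hn.
have [hst|/forallPn[f hf]] := boolP [forall f, prune f H == H].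
  by exists H; [exact: connect0|move=> f; apply/eqP/(forallP hst)].
have [H1 h1 /proper_card] := prune_step hf; rewrite hn => lt1.
have [H' h' hst] := IH _ lt1 H1 erefl.
by exists H' => //; apply: connect_trans (connect1 h1) h'.
Qed.

Lemma prune_all_sub H : prune_all H \subset H.
Proof. by rewrite /prune_all !(subset_trans (prune_sub _ _)). Qed.

(** The three prunings only shrink, so an edge lost by one could not be restored by the next. *)
Lemma prune_all_stable H : prune_all H = H -> stable H.
Proof.
rewrite /prune_all; set f2 := coord _; set f1 := coord _; set f0 := coord _.
move=> h; have e0 : prune f0 H = H.
  apply/eqP; rewrite eqEsubset prune_sub -{1}h.
  exact: subset_trans (prune_sub _ _) (prune_sub _ _).
rewrite e0 in h; have e1 : prune f1 H = H.
  by apply/eqP; rewrite eqEsubset prune_sub -{1}h prune_sub.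
rewrite e1 in h; move=> [i hi].
have : [|| Ordinal hi == f0, Ordinal hi == f1 | Ordinal hi == f2].
  by case: i hi => [|[|[|]]].
by case/or3P => /eqP->.
Qed.

(** Each round loses an edge unless a fixed point is reached; after [#|H|] losses the graph is
    empty, which is a fixed point too. *)
Lemma iter_prune_all_stable n H : #|H| <= n -> stable (iter n prune_all H).
Proof.
move=> hn; apply: prune_all_stable; set K := iter n _ _.
have : #|K| + n <= #|H| \/ prune_all K = K.
  rewrite /K {K hn}; elim: n => [|n [IH|IH]]; first by left; rewrite addn0.
    have [e|ne] := eqVneq (prune_all (iter n prune_all H)) (iter n prune_all H).
      by right; rewrite iterS e.
    left; apply: leq_trans IH; rewrite addnS -addSn leq_add2r.
    by apply: proper_card; rewrite properEneq ne prune_all_sub.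
  by right; rewrite iterS !IH.
case=> // hK; have /eqP : #|K| = 0 by lia.
by rewrite cards_eq0 => /eqP ->; apply/eqP; rewrite -subset0 prune_all_sub.
Qed.

Lemma stable_sub_iter n H K :
  stable K -> K \subset H -> K \subset iter n prune_all H.
Proof.
move=> hK KH; elim: n => [//|n IH].
by rewrite iterS; do !apply: stable_sub_prune.
Qed.

Lemma iter_prune_all_sub n H : iter n prune_all H \subset H.
Proof.
by elim: n => [//|n IH]; rewrite iterS (subset_trans (prune_all_sub _)).
Qed.

(** If the trivial matching is reached, the pruned graph, being stable, has survived inside it.
    Conversely, any stable graph reached contains the trivial matching, itself stable, and lies in
    the pruned graph. *)
Lemma simplifies_to_trivial n H :
  trivial_matching U \subset H -> #|H| <= n ->
  simplifies_to H (trivial_matching U)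
    = (iter n prune_all H \subset trivial_matching U).
Proof.
move=> tH hn; apply/idP/idP => [|hsub].
  exact/stable_sub_simplifies/iter_prune_all_sub/iter_prune_all_stable.
have [H' hH' hst] := simplifies_to_stable H.
suff -> : trivial_matching U = H' by [].
apply/eqP; rewrite eqEsubset; apply/andP; split.
  exact: stable_sub_simplifies trivial_matching_stable tH hH'.
apply: subset_trans hsub; apply: stable_sub_iter hst _.
apply: (connect_closed (P := fun K => K \subset H) _ hH') => //.
move=> K K' /existsP[S /existsP[f /andP[_ /eqP->]]]; apply: subset_trans.
by apply/subsetP => e; rewrite inE => /andP[].
Qed.

End Stability.

(** * The program *)

(** Row-major addresses: vertices are digits in base [s]. *)
Definition pos2 a b := Plus (Times a Rows) b.
Definition pos3 a b c := pos2 (pos2 a b) c.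
Definition for2 c := For Rows (For Rows c).
Definition for3 c := For Rows (for2 c).
(** One of the two truncated differences vanishes, so the sum is the absolute difference and [equal]
    evaluates to 0 or 1. *)
Definition differ a b := Plus (Minus a b) (Minus b a).
Definition equal a b := Minus (Num 1) (differ a b).

Definition edge_pos := pos3 (Var 2) (Var 1) (Var 0).

Definition tail_vertex (f : 'I_3) := Var (if f == 0 :> nat then 1 else 2).
Definition head_vertex (f : 'I_3) := Var (if f == 2 :> nat then 1 else 0).

(* As loops count down, the symbols end up in reverse order: the rows are
   listed backwards, each of them from right to left. *)
Definition load : cmd :=
  For Rows (For Cols (Input Puzzle (Plus (Times (Var 1) Cols) (Var 0)))).

Definition symbol_test i a :=
  equal (Get Puzzle (Plus (Times (Var i) Cols) (Var 0))) (Num a).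

(** An edge is presumed present and erased by any column where exactly two conditions hold. The
    column loop shifts the indices of the three vertices by one. *)
Definition build : cmd :=
  for3 (Seq (Put Edges edge_pos (Num 1))
    (For Cols (When (equal (Plus (Plus (symbol_test 3 1) (symbol_test 2 2))
                                 (symbol_test 1 3)) (Num 2))
      (Put Edges (pos3 (Var 3) (Var 2) (Var 1)) (Num 0))))).

(** The first loop overwrites every pair and so also clears the relation left by an earlier
    pruning. *)
Definition closure_init f : cmd :=
  Seq (for2 (Put Reach (pos2 (Var 1) (Var 0)) (equal (Var 1) (Var 0))))
      (for3 (When (Get Edges edge_pos)
        (Put Reach (pos2 (tail_vertex f) (head_vertex f)) (Num 1)))).

(* The pivot is the outermost counter [Var 2]. *)
Definition warshall : cmd :=
  for3 (When (Get Reach (pos2 (Var 1) (Var 2)))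
    (When (Get Reach (pos2 (Var 2) (Var 0)))
      (Put Reach (pos2 (Var 1) (Var 0)) (Num 1)))).

(** [Reach] stays fixed during this pass, so deletions in place do not affect later tests. *)
Definition delete f : cmd :=
  for3 (When (Get Edges edge_pos)
    (When (Minus (Num 1) (Get Reach (pos2 (head_vertex f) (tail_vertex f))))
      (Put Edges edge_pos (Num 0)))).

Definition prune_cmd f : cmd :=
  Seq (Seq (closure_init f) warshall) (delete f).

Definition prune_all_cmd : cmd :=
  Seq (Seq (prune_cmd (coord (isT : 0 < 3))) (prune_cmd (coord (isT : 1 < 3))))
      (prune_cmd (coord (isT : 2 < 3))).

(* The array [Reach] is no longer needed; its cell 0 receives the answer. *)
Definition verdict : cmd :=
  Seq (Put Reach (Num 0) (Num 1))
    (for3 (When (Get Edges edge_pos)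
      (When (Plus (differ (Var 2) (Var 1)) (differ (Var 1) (Var 0)))
        (Put Reach (Num 0) (Num 0))))).

(** Here [for3] serves only to repeat the pruning [s^3] times. *)
Definition susp_cmd : cmd :=
  Seq (Seq (Seq load build) (for3 prune_all_cmd)) verdict.

(** * Correctness of the program *)

Lemma differ_eq0 m n : (m - n + (n - m) == 0) = (m == n).
Proof. by lia. Qed.

Lemma equal_nat m n : 1 - (m - n + (n - m)) = (m == n).
Proof. by case: eqP; lia. Qed.

Lemma load_correct s k env m :
  let m' := sem s k env m load in
  forall n, n < s * k -> puzzle m' n = nth 0 (tape m) (s * k - n.+1).
Proof.
(* With [p] cells still to fill, [s * k - p] entries have been read; the descending counters put the
   first entry into the last cell. *)
pose I p m' := tape m' = drop (s * k - p) (tape m) /\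
  forall n, p <= n < s * k -> puzzle m' n = nth 0 (tape m) (s * k - n.+1).
suff [_ h] : I 0 (sem s k env m load) by move=> m' n hn; apply: h.
apply: (forloop_ind (I := fun j => I (j * k))).
  by split=> [|n]; [rewrite subnn drop0|rewrite /=; lia].
move=> i m1 hi h1; rewrite -[i * k]addn0.
apply: (forloop_ind (I := fun j => I (i * k + j))).
  by rewrite /= addnC -mulSn.
move=> j m2; rewrite /= => hj [ht h2].
have hp : i * k + j < s * k.
  apply: (@leq_trans (i.+1 * k)); first by rewrite mulSn; lia.
  by rewrite leq_mul2r hi orbT.
split=> [|n hn] /=.
  rewrite ht -drop1 drop_drop; congr drop; lia.
rewrite /set_reg; case: eqP => [->|ne]; last by apply: h2; lia.
by rewrite ht -nth0 nth_drop addn0 addnS.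
Qed.

Section Program.
Variables (s k : nat) (U : finType) (idx : U -> nat).
Hypothesis idx_inj : injective idx.
Hypothesis idx_lt : forall x, idx x < s.
Hypothesis idx_onto : forall j, j < s -> exists x, idx x = j.

Local Notation sem := (sem s k).

(** The visited vertices form an upper segment of the numbering, but indexing [I] by their set hides
    the order. *)
Lemma for1_ind (I : {set U} -> memory -> Prop) env m c :
  I set0 m ->
  (forall A x m', I A m' -> I (x |: A) (sem (idx x :: env) m' c)) ->
  I setT (sem env m (For Rows c)).
Proof.
move=> h0 hS.
have := @forloop_ind (fun j => I [set x | j <= idx x]) s
  (fun j m => sem (j :: env) m c) m.
have -> : [set x | 0 <= idx x] = setT by apply/setP=> x; rewrite !inE.
apply.
  suff -> : [set x | s <= idx x] = set0 by [].
  by apply/setP=> x; rewrite !inE leqNgt idx_lt.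
move=> j m' /idx_onto[x <-] /(hS _ x).
suff -> : x |: [set y | idx x < idx y] = [set y | idx x <= idx y] by apply.
by apply/setP=> y; rewrite !inE [RHS]leq_eqVlt (inj_eq idx_inj) eq_sym.
Qed.

Lemma for2_ind (I : {set U * U} -> memory -> Prop) env m c :
  I set0 m ->
  (forall A x y m', I A m' ->
     I ((x, y) |: A) (sem (idx y :: idx x :: env) m' c)) ->
  I setT (sem env m (for2 c)).
Proof.
move=> h0 hS; rewrite -[setT](_ : setX setT setT = _); last first.
  by apply/setP=> -[x y]; rewrite !inE.
apply: (for1_ind (I := fun A => I (setX A [set: U]))).
  suff -> : setX set0 [set: U] = set0 :> {set U * U} by [].
  by apply/setP=> -[x y]; rewrite !inE.
move=> A x m1 h1.
have -> : setX (x |: A) [set: U] = setX [set x] [set: U] :|: setX A [set: U].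
  by apply/setP=> -[y z]; rewrite !inE !andbT.
(* Visited so far: the full rows of [A] and the part [B] of row [x]. *)
apply: (for1_ind (I := fun B => I (setX [set x] B :|: setX A [set: U]))).
  suff -> : setX [set x] set0 = set0 :> {set U * U} by rewrite set0U.
  by apply/setP=> -[y z]; rewrite !inE andbF.
move=> B y m2 /(hS _ x y) h2.
suff -> : setX [set x] (y |: B) :|: setX A [set: U]
  = (x, y) |: (setX [set x] B :|: setX A [set: U]) by [].
by apply/setP=> -[z t]; rewrite !inE !andbT andb_orr orbA xpair_eqE.
Qed.

Lemma for3_ind (I : {set U * U * U} -> memory -> Prop) env m c :
  I set0 m ->
  (forall A x y z m', I A m' ->
     I ((x, y, z) |: A) (sem [:: idx z, idx y, idx x & env] m' c)) ->
  I setT (sem env m (for3 c)).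
Proof.
pose tr (B : {set U * (U * U)}) :=
  [set e : U * U * U | (e.1.1, (e.1.2, e.2)) \in B].
move=> h0 hS; rewrite -[setT](_ : tr (setX setT setT) = _); last first.
  by apply/setP=> -[[x y] z]; rewrite !inE.
apply: (for1_ind (I := fun A => I (tr (setX A [set: U * U])))).
  suff -> : tr (setX set0 [set: U * U]) = set0 by [].
  by apply/setP=> -[[x y] z]; rewrite !inE.
move=> A x m1 h1.
have -> : tr (setX (x |: A) [set: U * U])
  = tr (setX [set x] [set: U * U]) :|: tr (setX A [set: U * U]).
  by apply/setP=> -[[y z] t]; rewrite !inE !andbT.
apply: (for2_ind (I := fun B =>
  I (tr (setX [set x] B) :|: tr (setX A [set: U * U])))).
  suff -> : tr (setX [set x] set0) = set0 by rewrite set0U.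
  by apply/setP=> -[[y z] t]; rewrite !inE andbF.
move=> B y z m2 /(hS _ x y z) h2.
suff -> : tr (setX [set x] ((y, z) |: B)) :|: tr (setX A [set: U * U])
  = (x, y, z) |: (tr (setX [set x] B) :|: tr (setX A [set: U * U])) by [].
apply/setP=> -[[a b] c']; rewrite !inE !andbT /= !xpair_eqE.
by rewrite andb_orr orbA -andbA.
Qed.

(** For bodies that are merely repeated: [I] records how often, and the increment [d] lets the rule
    be nested. *)
Lemma for_count (I : nat -> memory -> Prop) env c d r m :
  (forall r m env, I r m -> I (r + d) (sem env m c)) ->
  I r m -> I (r + s * d) (sem env m (For Rows c)).
Proof.
move=> hc hr; pose J j m' := I (r + (s - j) * d) m'.
have := @forloop_ind J s (fun j m => sem (j :: env) m c) m.
rewrite /J subn0 subnn addn0; apply=> // j m' hj /hc - /(_ (j :: env)).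
by rewrite -addnA -mulSnr subnSK.
Qed.

Lemma for3_count (I : nat -> memory -> Prop) env c r m :
  (forall r m env, I r m -> I r.+1 (sem env m c)) ->
  I r m -> I (r + s * (s * s)) (sem env m (for3 c)).
Proof.
move=> hc; do 2!apply: for_count => {r m env} r m env.
rewrite -[in r + s](muln1 s); apply: for_count => {}r {}m {}env.
by rewrite addn1; apply: hc.
Qed.

Definition pair_index (p : U * U) := idx p.1 * s + idx p.2.

Definition edge_index (e : U * U * U) := pair_index e.1 * s + idx e.2.

Lemma addr_inj a b x y : a * s + idx x = b * s + idx y -> a = b /\ x = y.
Proof.
have s0 := leq_ltn_trans (leq0n _) (idx_lt x) => h.
have := congr1 (divn^~ s) h; rewrite !divnMDl // !divn_small // !addn0 => e.
by split=> //; apply: idx_inj; rewrite e in h; apply: addnI h.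
Qed.

Lemma pair_index_inj : injective pair_index.
Proof. by move=> [x y] [x' y'] /addr_inj[/= /idx_inj -> ->]. Qed.

Lemma edge_index_inj : injective edge_index.
Proof. by move=> [x y] [x' y'] /addr_inj[/= /pair_index_inj -> ->]. Qed.

Definition edges_are m (H : graph3 U) :=
  forall e, edges m (edge_index e) = (e \in H).

Definition reach_is m (r : {set U * U}) :=
  forall p, reach m (pair_index p) = (p \in r).

Lemma build_correct (sym : U -> nat -> nat) env m :
  (forall u i, i < k -> puzzle m (idx u * k + i) = sym u i) ->
  edges_are (sem env m build)
    [set e | all (fun i => (sym e.1.1 i == 1) + (sym e.1.2 i == 2)
                           + (sym e.2 i == 3) != 2) (iota 0 k)].
Proof.
move=> hsym; set H := [set _ | _].
pose I (A : {set U * U * U}) m' := puzzle m' = puzzle m /\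
  forall e, e \in A -> edges m' (edge_index e) = (e \in H).
suff [_ h] : I setT (sem env m build) by move=> e; rewrite h ?inE.
apply: for3_ind; first by split=> // e; rewrite inE.
move=> A u v w m1 [hp1 he1].
pose ok i := (sym u i == 1) + (sym v i == 2) + (sym w i == 3) != 2.
(* Counting down, columns [j] to [k - 1] have been tested for the current triple. *)
pose J j m' := puzzle m' = puzzle m /\
  forall e, e \in (u, v, w) |: A -> edges m' (edge_index e)
    = if e == (u, v, w) then all ok (iota j (k - j)) else e \in H.
suff [hp h] : J 0 (sem [:: idx w, idx v, idx u & env] m1
    (Seq (Put Edges edge_pos (Num 1)) (For Cols (When (equal (Plus (Plus
     (symbol_test 3 1) (symbol_test 2 2)) (symbol_test 1 3)) (Num 2))
      (Put Edges (pos3 (Var 3) (Var 2) (Var 1)) (Num 0)))))).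
  split=> // e /h ->; case: eqP => // ->.
  by rewrite [in RHS]inE subn0.
apply: (forloop_ind (I := J)).
  split=> // e; rewrite subnn /= -[_ + idx w]/(edge_index (u, v, w)).
  rewrite /set_reg (inj_eq edge_index_inj) in_setU1.
  by case: eqP => //= _; apply: he1.
move=> j m2 hj [hp2 he2].
have hiota : iota j (k - j) = j :: iota j.+1 (k - j.+1) by rewrite -subnSK.
rewrite /= !equal_nat !hp2 !hsym //.
rewrite lt0b; case: ifP => hok; split=> //= e he; last first.
  by rewrite he2 // hiota /= /ok hok.
rewrite -[_ + idx w]/(edge_index (u, v, w)).
rewrite /set_reg (inj_eq edge_index_inj) he2 //.
by case: eqP => // _; rewrite hiota /= /ok hok.
Qed.

Lemma eval_edge_pos m x y z env :
  eval s k [:: idx z, idx y, idx x & env] m edge_pos = edge_index (x, y, z).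
Proof. by []. Qed.

Lemma eval_arc m f x y z env :
  eval s k [:: idx z, idx y, idx x & env] m
    (pos2 (tail_vertex f) (head_vertex f))
    = pair_index (drop_coord f (x, y, z)).
Proof. by case: f => -[|[|[|]]]. Qed.

Lemma eval_coarc m f x y z env :
  eval s k [:: idx z, idx y, idx x & env] m
    (pos2 (head_vertex f) (tail_vertex f))
    = pair_index ((drop_coord f (x, y, z)).2, (drop_coord f (x, y, z)).1).
Proof. by case: f => -[|[|[|]]]. Qed.

Lemma reach_is_put m r p (b : bool) :
  reach_is m r ->
  forall q, reach (put m Reach (pair_index p) b) (pair_index q)
    = if q == p then b else q \in r.
Proof.
move=> hr q; rewrite /= /set_reg (inj_eq pair_index_inj) hr.
by case: eqP; case: b.
Qed.

Lemma sem_seq env m c1 c2 : sem env m (Seq c1 c2) = sem env (sem env m c1) c2.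
Proof. by []. Qed.

Lemma sem_when env m e c :
  sem env m (When e c) = if 0 < eval s k env m e then sem env m c else m.
Proof. by []. Qed.

Lemma sem_put env m a e1 e2 :
  sem env m (Put a e1 e2) = put m a (eval s k env m e1) (eval s k env m e2).
Proof. by []. Qed.

Lemma eval_get env m a e :
  eval s k env m (Get a e) = get m a (eval s k env m e).
Proof. by []. Qed.

Lemma closure_init_correct f H env m :
  edges_are m H ->
  let m' := sem env m (closure_init f) in
  edges m' = edges m /\
  reach_is m' ([set p | p.1 == p.2] :|: projection f H).
Proof.
move=> hH; pose diag := [set p : U * U | p.1 == p.2].
pose I (A : {set U * U}) m' := edges m' = edges m /\
  forall p, p \in A -> reach m' (pair_index p) = (p \in diag).
have : I setT (sem env m (for2 (Put Reach (pos2 (Var 1) (Var 0))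
                                 (equal (Var 1) (Var 0))))).
  apply: for2_ind; first by split=> // p; rewrite inE.
  move=> A x y m1 [he hr]; split=> // p.
  rewrite in_setU1 /= equal_nat (inj_eq idx_inj).
  rewrite -[_ + idx y]/(pair_index (x, y)) /set_reg (inj_eq pair_index_inj).
  by case: eqP => [->|_] //=; [rewrite inE|exact: hr].
rewrite /closure_init sem_seq; set m1 := sem env m (for2 _) => -[he1 hr1].
pose J A m' := edges m' = edges m /\
  reach_is m' (diag :|: projection f (A :&: H)).
suff : J setT (sem env m1 (for3 (When (Get Edges edge_pos)
    (Put Reach (pos2 (tail_vertex f) (head_vertex f)) (Num 1))))).
  by case=> he2; rewrite setTI.
apply: for3_ind.
  by split=> // p; rewrite hr1 ?in_setT // set0I /projection imset0 setU0.
move=> A x y z m2 [he2 hr2].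
rewrite sem_when eval_get eval_edge_pos /get he2 hH lt0b.
case: ifP => hxyz.
  rewrite sem_put eval_arc; split=> // p; rewrite (reach_is_put _ true hr2).
  have -> : ((x, y, z) |: A) :&: H = (x, y, z) |: (A :&: H).
    by apply/setP=> e; rewrite !inE; case: eqP => // ->; rewrite hxyz.
  by rewrite /projection imsetU1 !in_setU in_set1; case: eqP; rewrite ?orbT.
split=> //; suff -> : ((x, y, z) |: A) :&: H = A :&: H by [].
by apply/setP=> e; rewrite !inE; case: eqP => // ->; rewrite hxyz !andbF.
Qed.

(** Paths with interior in the set [A] of past pivots need no exact description: it suffices that
    the stored relation lies between the initial one and reachability and is transitive through [A].
    Once [A] is everything, it is reachability. *)
Lemma warshall_correct (p0 : {set U * U}) env m :
  reach_is m ([set p | p.1 == p.2] :|: p0) ->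
  let m' := sem env m warshall in
  edges m' = edges m /\
  reach_is m' [set p | connect (pair_rel p0) p.1 p.2].
Proof.
move=> h0.
pose W (A : {set U}) m' := edges m' = edges m /\
  exists r : {set U * U}, [/\ reach_is m' r,
    [set p | p.1 == p.2] :|: p0 \subset r,
    forall x y, (x, y) \in r -> connect (pair_rel p0) x y &
    forall z x y, z \in A -> (x, z) \in r -> (z, y) \in r -> (x, y) \in r].
suff [he [r [hr /subsetP r0 rc rt]]] : W setT (sem env m warshall).
  split=> // -[x y]; rewrite hr inE /=; congr (nat_of_bool _).
  apply/idP/idP=> [|hxy]; first exact: rc.
  refine (connect_closed (P := fun y => (x, y) \in r) _ hxy _).
    move=> a b ab xa; apply: rt xa _; first by rewrite inE.
    by apply: r0; rewrite in_setU orbC; apply/orP; left.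
  by apply: r0; rewrite !inE eqxx.
apply: for1_ind.
  split=> //; exists ([set p | p.1 == p.2] :|: p0); split=> //.
  - move=> x y; rewrite !inE => /orP[/eqP /= ->|xy]; first exact: connect0.
    exact: connect1.
  - by move=> z x y; rewrite inE.
move=> A z m1 [he1 [r [hr r0 rc rt]]].
pose J (B : {set U * U}) m' := edges m' = edges m /\
  reach_is m' (r :|: [set p in B | ((p.1, z) \in r) && ((z, p.2) \in r)]).
have : J setT (sem (idx z :: env) m1
    (for2 (When (Get Reach (pos2 (Var 1) (Var 2)))
    (When (Get Reach (pos2 (Var 2) (Var 0)))
      (Put Reach (pos2 (Var 1) (Var 0)) (Num 1)))))).
  apply: for2_ind.
    by split=> // p; rewrite hr; congr (nat_of_bool _); rewrite !inE orbF.
  move=> B x y m2 [he2 hr2].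
  (* Row and column z do not change during the pass with pivot z, so that
     the update can be made in place. *)
  have rz u : reach m2 (pair_index (u, z)) = ((u, z) \in r).
    rewrite hr2 !inE /=; congr (nat_of_bool _).
    by case: (boolP ((u, z) \in r)) => //= _; rewrite andbF.
  have zr u : reach m2 (pair_index (z, u)) = ((z, u) \in r).
    rewrite hr2 !inE /=; congr (nat_of_bool _).
    by case: (boolP ((z, u) \in r)) => //= _; rewrite !andbF.
  have hstep : sem [:: idx y, idx x, idx z & env] m2
      (When (Get Reach (pos2 (Var 1) (Var 2)))
        (When (Get Reach (pos2 (Var 2) (Var 0)))
          (Put Reach (pos2 (Var 1) (Var 0)) (Num 1))))
      = if ((x, z) \in r) && ((z, y) \in r)
        then put m2 Reach (pair_index (x, y)) true else m2.
    rewrite !sem_when !eval_get /get -[eval _ _ _ _ _]/(pair_index (x, z)).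
    rewrite rz lt0b -[eval _ _ _ _ _]/(pair_index (z, y)) zr lt0b.
    by case: ((x, z) \in r).
  rewrite hstep; case: ifP => hxy.
    split=> // p; rewrite (reach_is_put _ true hr2) !inE.
    by case: eqP => [->|] //=; rewrite hxy orbT.
  split=> // p; rewrite hr2 !inE; congr (nat_of_bool _).
  by case: eqP => // ->; rewrite /= hxy !andbF.
move=> [he2 hr2]; split=> //.
exists (r :|: [set p in setT | ((p.1, z) \in r) && ((z, p.2) \in r)]).
split=> //.
- by apply: subset_trans r0 _; apply: subsetUl.
- move=> x y; rewrite !inE /= => /orP[|/andP[xz zy]]; first exact: rc.
  by apply: connect_trans (rc _ _ xz) (rc _ _ zy).
(* Through the new pivot [z], composites are just the added pairs. Through an old pivot [t], an
   added pair splits at [z] and transitivity of [r] through [t] joins the pieces. *)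
- move=> t x y; rewrite !inE /= => /orP[/eqP->|tA].
    move=> /orP[xz|/andP[xz _]] /orP[zy|/andP[_ zy]];
      by rewrite xz zy orbT.
  move=> /orP[xt|/andP[xz zt]] /orP[ty|/andP[tz zy]].
  + by rewrite (rt _ _ _ tA xt ty).
  + by rewrite (rt _ _ _ tA xt tz) zy orbT.
  + by rewrite (rt _ _ _ tA zt ty) xz orbT.
  + by rewrite xz zy orbT.
Qed.

Lemma delete_correct f H (r : {set U * U}) env m :
  edges_are m H -> reach_is m r ->
  edges_are (sem env m (delete f))
    [set e in H | ((drop_coord f e).2, (drop_coord f e).1) \in r].
Proof.
move=> hH hr.
pose ok e := ((drop_coord f e).2, (drop_coord f e).1) \in r.
pose I (A : {set U * U * U}) m' := reach_is m' r /\
  edges_are m' [set e in H | (e \in A) ==> ok e].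
suff [_ h] : I setT (sem env m (delete f)).
  by move=> e; rewrite h !inE.
apply: for3_ind.
  by split=> // e; rewrite hH; congr (nat_of_bool _); rewrite !inE andbT.
move=> A x y z m1 [hr1 he1].
rewrite !sem_when eval_get eval_edge_pos /get he1 lt0b.
have -> : eval s k [:: idx z, idx y, idx x & env] m1
    (Minus (Num 1) (Get Reach (pos2 (head_vertex f) (tail_vertex f))))
    = ~~ ok (x, y, z).
  rewrite -[LHS]/(1 - eval s k [:: idx z, idx y, idx x & env] m1
    (Get Reach (pos2 (head_vertex f) (tail_vertex f)))) eval_get eval_coarc.
  by rewrite /get hr1 /ok; case: (_ \in r).
rewrite lt0b; case: ifP => [hin|hin]; last first.
  split=> // e; rewrite he1; congr (nat_of_bool _); rewrite !inE.
  case: eqP => // ->; move: hin; rewrite inE /=.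
  by case: (_ \in H) => //=; case: (_ \in A) => //= ->.
case: ifP => hok.
  split=> // e; rewrite sem_put eval_edge_pos /= /set_reg.
  rewrite (inj_eq edge_index_inj) he1 !inE.
  by case: eqP => // ->; rewrite (negPf hok) andbF.
split=> // e; rewrite he1; congr (nat_of_bool _); rewrite !inE.
case: eqP => // ->; move: hok => /negbFE ->.
by rewrite !implybT.
Qed.

Lemma prune_correct f H env m :
  edges_are m H -> edges_are (sem env m (prune_cmd f)) (prune f H).
Proof.
move=> hH; have [he1 hr1] := closure_init_correct f env hH.
have [he2 hr2] := warshall_correct env hr1.
have hH2 : edges_are (sem env (sem env m (closure_init f)) warshall) H.
  by move=> e; rewrite he2 he1.
move=> e; rewrite (delete_correct f env hH2 hr2 e).
by congr (nat_of_bool _); rewrite !inE.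
Qed.

Lemma prune_all_correct H env m :
  edges_are m H -> edges_are (sem env m prune_all_cmd) (prune_all H).
Proof. by move=> hH; do !apply: prune_correct. Qed.

Lemma verdict_correct H env m :
  edges_are m H ->
  reach (sem env m verdict) 0 = (H \subset trivial_matching U).
Proof.
move=> hH; pose I (A : {set U * U * U}) m' := edges m' = edges m /\
  reach m' 0 = (A :&: H \subset trivial_matching U).
suff [_ h] : I setT (sem env m verdict) by rewrite h setTI.
rewrite /verdict sem_seq; apply: for3_ind.
  by split=> //=; rewrite set0I sub0set.
move=> A x y z m1 [he1 hr1].
rewrite !sem_when eval_get eval_edge_pos /get he1 hH lt0b.
case: ifP => hxyz; last first.
  split=> //; suff -> : ((x, y, z) |: A) :&: H = A :&: H by [].
  by apply/setP=> e; rewrite !inE; case: eqP => // ->; rewrite hxyz !andbF.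
rewrite /I; have -> : ((x, y, z) |: A) :&: H = (x, y, z) |: (A :&: H).
  by apply/setP=> e; rewrite !inE; case: eqP => // ->; rewrite hxyz.
have -> : 0 < eval s k [:: idx z, idx y, idx x & env] m1
    (Plus (differ (Var 2) (Var 1)) (differ (Var 1) (Var 0)))
    = ((x, y, z) \notin trivial_matching U).
  rewrite lt0n -[eval _ _ _ _ _]/((idx x - idx y + (idx y - idx x))
    + (idx y - idx z + (idx z - idx y))) addn_eq0 !differ_eq0.
  rewrite !(inj_eq idx_inj); congr (~~ _).
  apply/andP/imsetP=> [[/eqP-> /eqP->]|[u _ [-> -> ->]]]; last by [].
  by exists z.
rewrite subUset sub1set.
by case: ((x, y, z) \in _); split.
Qed.

Hypothesis card_U : #|U| = s.

Lemma susp_cmd_correct (sym : U -> nat -> nat) t :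
  (forall u i, i < k -> nth 0 t (s * k - (idx u * k + i).+1) = sym u i) ->
  let H := [set e : U * U * U |
    all (fun i => (sym e.1.1 i == 1) + (sym e.1.2 i == 2)
                  + (sym e.2 i == 3) != 2) (iota 0 k)] in
  trivial_matching U \subset H ->
  reach (sem [::] (Memory (fun=> 0) (fun=> 0) (fun=> 0) t) susp_cmd) 0
    = simplifies_to H (trivial_matching U).
Proof.
move=> hsym H tH; rewrite /susp_cmd; set m0 := Memory _ _ _ _.
have hpuz u i : i < k -> puzzle (sem [::] m0 load) (idx u * k + i) = sym u i.
  move=> hi; rewrite load_correct ?hsym //.
  apply: (@leq_trans ((idx u).+1 * k)); first by rewrite mulSn; lia.
  by rewrite leq_mul2r idx_lt orbT.
have hH := build_correct [::] hpuz; rewrite -/H in hH.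
pose I r m := edges_are m (iter r (@prune_all U) H).
have hI := @for3_count I [::] prune_all_cmd 0 _
  (fun r m env => @prune_all_correct _ env m) hH.
rewrite !sem_seq (verdict_correct [::] hI) add0n.
rewrite -simplifies_to_trivial //; apply: leq_trans (max_card _) _.
by rewrite !card_prod card_U mulnA.
Qed.

End Program.

(** * Puzzles *)

Lemma nth_flatten_uniform (T : Type) (x0 : T) k (ss : seq (seq T)) i j :
  all (fun r => size r == k) ss -> j < k ->
  nth x0 (flatten ss) (i * k + j) = nth x0 (nth [::] ss i) j.
Proof.
move=> + hj; elim: ss i => [|r ss IH] i /=; first by rewrite !nth_nil.
case/andP=> /eqP hr hss; rewrite nth_cat hr.
case: i => [|i] /=; first by rewrite mul0n hj.
have -> : (i.+1 * k + j < k) = false by rewrite mulSn; lia.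
by rewrite -IH //; congr nth; rewrite mulSn; lia.
Qed.

(** The row as it stands in the array [Puzzle] after loading. *)
Definition reversed_symbol k (r : puzzle_row k) i :=
  nth 0 (rev (map symbol r)) i.

Lemma reversed_symbolE k (r : puzzle_row k) (i : 'I_k) :
  reversed_symbol r i = symbol (tnth r (rev_ord i)).
Proof.
rewrite /reversed_symbol nth_rev size_map size_tuple //.
rewrite (tnth_nth (tnth r i)).
by rewrite (nth_map (tnth r i)) ?size_tuple ?rev_ord_proof.
Qed.

(** The condition ranges over all columns, so reversing the three rows alike does not change it. *)
Lemma puzzle_edgeE k (u v w : puzzle_row k) :
  puzzle_edge u v w
    = all (fun i => (reversed_symbol u i == 1) + (reversed_symbol v i == 2)
                    + (reversed_symbol w i == 3) != 2) (iota 0 k).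
Proof.
rewrite /puzzle_edge negb_exists; apply/forallP/allP => [h i|h i].
  rewrite mem_iota => /= hi; rewrite -[i]/(val (Ordinal hi)).
  by rewrite !reversed_symbolE.
have := h (rev_ord i); rewrite mem_iota !reversed_symbolE rev_ordK.
by apply; exact: ltn_ord.
Qed.

(** When the three rows coincide, exactly one condition holds in each column, never two. *)
Lemma trivial_matching_sub_puzzle_graph k (P : {set puzzle_row k}) :
  trivial_matching {u | u \in P} \subset puzzle_graph P.
Proof.
apply/subsetP => _ /imsetP[u _ ->]; rewrite inE /puzzle_edge negb_exists.
by apply/forallP => i; case: (tnth _ i) => -[|[|[|]]].
Qed.

Theorem theorem1 :
  exists (M : program) (T : {poly {poly nat}}),
    forall (s k : nat) (P : {set puzzle_row k}), is_puzzle s P ->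
    forall l : seq (puzzle_row k), is_listing P l ->
      run M (eval2 T s k) (initial_config (encode_puzzle s l))
        = Some (simplifiable_SUSP P).
Proof.
exists (decider susp_cmd (Get Reach (Num 0))).
exists (decider_time susp_cmd (Get Reach (Num 0))).
move=> s k P hs l [ul lP].
have sl : size l = s by rewrite -hs -(card_uniqP ul); apply: eq_card.
rewrite decider_correct eval_get /get; set t := flatten _.
(* Vertices are numbered along [rev l] because loading stores the last row first. *)
pose idx (u : {u | u \in P}) := index (val u) (rev l).
have in_rev (u : {u | u \in P}) : val u \in rev l.
  by rewrite mem_rev lP (valP u).
have idx_inj : injective idx.
  by move=> u v e; apply: val_inj; rewrite -(nth_index (val u) (in_rev u))
    -[index _ _]/(idx u) e nth_index.
have idx_lt u : idx u < s by rewrite -sl -size_rev index_mem.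
have idx_onto j : j < s -> exists u, idx u = j.
  move=> hj; pose x0 : puzzle_row k := [tuple of nseq k ord0].
  have hP : nth x0 (rev l) j \in P.
    by rewrite -lP -mem_rev mem_nth // size_rev sl.
  exists (exist (fun u => u \in P) _ hP); rewrite /idx /= index_uniq ?rev_uniq //.
  by rewrite size_rev sl.
have card_U : #|{: {u | u \in P}}| = s by rewrite card_sig -hs; apply: eq_card.
pose sym (u : {u | u \in P}) := reversed_symbol (val u).
have sz : size t = s * k.
  rewrite /t -sl; elim: (l) => //= r l' IH.
  by rewrite size_cat size_map size_tuple IH mulSn.
have hsym u i : i < k -> nth 0 t (s * k - (idx u * k + i).+1) = sym u i.
  move=> hi; rewrite -sz -nth_rev; last first.
    rewrite sz; apply: (@leq_trans ((idx u).+1 * k)); first by rewrite mulSn; lia.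
    by rewrite leq_mul2r idx_lt orbT.
  (* Reversing the tape reverses both the order of the rows and each single row. *)
  rewrite /t rev_flatten -!map_rev nth_flatten_uniform //; last first.
    apply/allP => _ /mapP[_ /mapP[r _ ->] ->].
    by rewrite size_rev size_map size_tuple.
  by rewrite -map_comp (nth_map (val u)) ?nth_index // size_rev sl.
have tH := trivial_matching_sub_puzzle_graph P.
have HE : puzzle_graph P = [set e |
    all (fun i => (sym e.1.1 i == 1) + (sym e.1.2 i == 2)
                  + (sym e.2 i == 3) != 2) (iota 0 k)].
  by apply/setP => e; rewrite !inE puzzle_edgeE.
rewrite HE in tH.
rewrite (susp_cmd_correct idx_inj idx_lt idx_onto card_U hsym tH) lt0b.
by rewrite /simplifiable_SUSP HE.
Qed.
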